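(* Let $\alpha\in(0,1/2)$ be irrational with continued fraction expansion $\alpha=[0;a_1,a_2,\ldots]$ and let $(q_k)_{k\ge0}$ be the denominators of its convergents. If $m$ is the minimum abelian period of a nonempty factor of a Sturmian word of slope $\alpha$, then either $m=tq_k$ for some $k\ge0$ and some integer $t$ with $1\le t\le a_{k+1}$, or $m=\ell q_k+q_{k-1}$ for some $k\ge1$ and some integer $\ell$ with $1\le \ell<a_{k+1}$.
   Context: Continued fractions: $a_i$ are positive integers; $q_{-1}=0$, $q_0=1$, $q_1=a_1$, $q_k=a_kq_{k-1}+q_{k-2}$ for $k\ge2$. Sturmian words: identify the circle $\mathbb{T}$ with $[0,1)$, let $R(\rho)=\{\rho+\alpha\}$ ($\{\cdot\}$ = fractional part), and fix one of two conventions: $I_0=[0,1-\alpha)$, $I_1=[1-\alpha,1)$, or $I_0=(0,1-\alpha]$, $I_1=(1-\alpha,1]$. For $\rho\in\mathbb{T}$, the Sturmian word of slope $\alpha$ and intercept $\rho$ is the infinite binary word whose $n$-th letter ($n\ge0$) is $0$ if $R^n(\rho)\in I_0$ and $1$ otherwise; the Sturmian words of slope $\alpha$ are all such words for all $\rho$ and both conventions (they all have the same set of finite factors). Abelian periods: the Parikh vector of a binary word $u$ is $(|u|_0,|u|_1)$; a Parikh vector $P$ is contained in $Q$ if $P\le Q$ componentwise and $P\ne Q$. An abelian decomposition of a word $w$ is a factorization $w=u_0u_1\cdots u_{n-1}u_n$ with $n\ge2$ such that $u_1,\dots,u_{n-1}$ have a common Parikh vector $P$ and the Parikh vectors of $u_0$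 and $u_n$ are contained in $P$; the common length of $u_1,\dots,u_{n-1}$ is then an abelian period of $w$. The minimum abelian period of $w$ is the least abelian period of $w$. *)

(* Defs.v *)
From mathcomp Require Import all_boot all_order all_algebra.
From mathcomp Require Import reals.
Set Implicit Arguments. Unset Strict Implicit. Unset Printing Implicit Defensive.
Import Order.TTheory GRing.Theory Num.Theory.
Local Open Scope ring_scope.

Section Defs.
Variable R : realType.

Definition fracp (x : R) : R := x - (Num.floor x)%:~R.

Fixpoint gauss (alpha : R) (k : nat) : R :=
  match k with
  | 0 => alpha
  | k'.+1 => fracp ((gauss alpha k')^-1)
  end.

(* partial quotients: alpha = [0; a_1, a_2, ...], a_{k+1} = floor(1/x_k);
   a_0 := 0 (= floor alpha for alpha in (0,1)) *)
Definition cf_a (alpha : R) (k : nat) : nat :=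
  match k with
  | 0 => 0%N
  | k'.+1 => Num.truncn ((gauss alpha k')^-1)
  end.

Fixpoint cf_q (alpha : R) (k : nat) : nat :=
  match k with
  | 0 => 1%N
  | 1 => cf_a alpha 1
  | (k'.+1 as k1).+1 => (cf_a alpha k1.+1 * cf_q alpha k1 + cf_q alpha k')%N
  end.

(* Sturmian word of slope alpha and intercept rho; conv = false:
   I_0 = [0, 1-alpha), conv = true: I_0 = (0, 1-alpha]  (circle = [0,1)). *)
Definition in_I0 (conv : bool) (alpha x : R) : bool :=
  if conv then (0 < x) && (x <= 1 - alpha) else (0 <= x) && (x < 1 - alpha).

Definition sturmian (conv : bool) (alpha rho : R) (n : nat) : nat :=
  if in_I0 conv alpha (fracp (rho + n%:R * alpha)) then 0%N else 1%N.

Definition sturmian_factor (alpha : R) (w : seq nat) : Prop :=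
  exists (conv : bool) (rho : R) (i : nat), 0 <= rho < 1 /\
    w = [seq sturmian conv alpha rho (i + j) | j <- iota 0 (size w)].

End Defs.

Definition parikh (u : seq nat) : nat * nat :=
  (count (pred1 0%N) u, count (pred1 1%N) u).

Definition pcontained (P Q : nat * nat) : bool :=
  [&& (P.1 <= Q.1)%N, (P.2 <= Q.2)%N & P != Q].

(* p is an abelian period of w: w = u_0 u_1 ... u_{n-1} u_n, n >= 2,
   us = [u_1; ...; u_{n-1}] nonempty, all with Parikh vector P of length p,
   and Parikh vectors of u_0, u_n contained in P. *)
Definition abelian_period (w : seq nat) (p : nat) : Prop :=
  exists (u0 un : seq nat) (us : seq (seq nat)) (P : nat * nat),
    [/\ us != [::], w = u0 ++ flatten us ++ un,
        all (fun u => (parikh u == P) && (size u == p)) us,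
        pcontained (parikh u0) P
      & pcontained (parikh un) P].

Definition min_abelian_period (w : seq nat) (m : nat) : Prop :=
  abelian_period w m /\ forall p, abelian_period w p -> (m <= p)%N.

(* Main.v *)
Require Import Defs.
From mathcomp Require Import all_boot all_order all_algebra.
From mathcomp Require Import reals.
From mathcomp Require Import zify ring lra.
Import Order.TTheory GRing.Theory Num.Theory.
Set Implicit Arguments. Unset Strict Implicit. Unset Printing Implicit Defensive.
Local Open Scope ring_scope.

(**
Let [q = q_k < m < D = q_{k+1}], let [m] be an abelian period of a factor [w] of
length [L], and suppose that [m] is neither a multiple [t q_k] nor a
semiconvergent denominator [l q_k + q_{k-1}].  Then [M = (m %/ q) q < m] is
an abelian period of [w] too, so [m] is not minimal.

Let [F i] be the number of 1's among the first [i] letters.  The deviation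
[i alpha - F i] stays in an interval of length 1, and it moves by a constant
from each block of an abelian decomposition to the next.  For blocks of length
[M] this constant is [t ||q_k alpha||], which is less than [||q_{k-1} alpha||],
hence less than [alpha] and than [1 - alpha]; head and tail of length less than
[M] are then contained in the Parikh vector of a block automatically, and it
only remains to find a starting point from which the [M]-steps (or the
underlying [q]-steps) never wrap around the interval.  Call [i] bad if the step
from [i] to [i + q] wraps around.  Bad indices are at least [D] apart, so fewer
than [q] of them fit into an interval of length [(q - 1) D], some class modulo [q]
avoids them, and this yields the start unless [L] is very large.  On the other
hand, [m] moves the deviation by at least
[||q_{k-1} alpha|| + ||q_k alpha||], so that [w] has at most [q - 1] blocks
of length [m].  In the only case which remains, [w] has exactly
[q - 1] blocks, and the first of them begins so close to a bad index, in time
and in deviation, that the best approximation property of [q_k] is violated.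
*)

(** * Best approximations *)

Section Convergents.
Variable R : realType.

(* [q = q_k], [q' = q_{k-1}] and [K = a_{k+1}], with [theta = alpha] or
   [theta = - alpha] according to the parity of [k], so that
   [b = ||q_k alpha||] and [a = ||q_{k-1} alpha||] appear without absolute values. *)
Record convergents (theta : R) (q q' K : nat) (p p' : int) (a b : R) : Prop :=
  Convergents {
  cv_q'_gt0 : (0 < q')%N;
  cv_q'_lt : (q' < q)%N;
  cv_K_gt0 : (0 < K)%N;
  cv_det : q%:Z * p' - q'%:Z * p = 1;
  cv_bE : b = q%:R * theta - p%:~R;
  cv_aE : a = p'%:~R - q'%:R * theta;
  cv_b_gt0 : 0 < b;
  cv_gt : K%:R * b < a;
  cv_lt : a < K.+1%:R * b }.

Variables (theta : R) (q q' K : nat) (p p' : int) (a b : R).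
Hypothesis cv : convergents theta q q' K p p' a b.

Let D : nat := (K * q + q')%N.

Lemma natr_ge1 (n : nat) : (0 < n)%N -> 1 <= n%:R :> R.
Proof. by move=> h; rewrite ler1n. Qed.

Lemma b_lt_a : b < a.
Proof.
have [q'_gt0 q'_lt K_gt0 det1 bE aE b_gt0 Kb_lt_a a_lt] := cv.
have := natr_ge1 K_gt0; nra.
Qed.

(** Substituting [a] and [b] cancels [theta] and leaves the determinant. Contradictions with the
    interval length 1 are measured against this sum. *)
Lemma cv_area : q%:R * a + q'%:R * b = 1.
Proof.
have [q'_gt0 q'_lt K_gt0 det1 bE aE b_gt0 Kb_lt_a a_lt] := cv.
have det1R : q%:R * p'%:~R - q'%:R * p%:~R = 1 :> R.
  by rewrite !pmulrn -!rmorphM -rmorphB /= det1.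
by rewrite -[RHS]det1R aE bE; ring.
Qed.

Lemma cv_Db_lt1 : D%:R * b < 1.
Proof.
have [q'_gt0 q'_lt K_gt0 det1 bE aE b_gt0 Kb_lt_a a_lt] := cv.
rewrite /D natrD natrM; have := cv_area; have := natr_ge1 (leq_ltn_trans (leq0n _) q'_lt); nra.
Qed.

Lemma cv_ab_lt1 : a + b < 1.
Proof.
have [q'_gt0 q'_lt K_gt0 det1 bE aE b_gt0 Kb_lt_a a_lt] := cv.
have := cv_area; have bla := b_lt_a; have : 2 <= q%:R :> R by rewrite ler_nat; lia.
have := natr_ge1 q'_gt0; nra.
Qed.

(* As the determinant is 1, every integer vector is a combination of [(q, p)] and
   [(q', p')]; the approximation bounds are read off its coefficients. *)
Lemma cv_lattice (n : nat) (z : int) : exists A B : int,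
  n%:Z = A * q%:Z + B * q'%:Z /\ n%:R * theta - z%:~R = A%:~R * b - B%:~R * a.
Proof.
have [q'_gt0 q'_lt K_gt0 det1 bE aE b_gt0 Kb_lt_a a_lt] := cv.
have [A [B [En Ez]]] : exists A B : int,
    n%:Z = A * q%:Z + B * q'%:Z /\ z = A * p + B * p'.
  exists (n%:Z * p' - z * q'%:Z), (q%:Z * z - p * n%:Z).
  by split; rewrite -[LHS]mulr1 -det1; ring.
exists A, B; split => //.
have EnR : n%:R = A%:~R * q%:R + B%:~R * q'%:R :> R.
  by rewrite !pmulrn -!rmorphM -rmorphD /= -En.
by rewrite Ez EnR rmorphD !rmorphM /= aE bE; ring.
Qed.

(** For [d = A q + B q'] the range of [d] excludes [B = 0]. The three cases are [B = 1] (then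
    [A = 0]), [B >= 2] with [A <= 0], and [B <= -1] with [A >= 1]. *)
Lemma dist_lt_q (d : nat) (z : int) : (0 < d < q)%N ->
  [\/ d = q' /\ d%:R * theta - z%:~R = - a,
      d%:R * theta - z%:~R <= - (2 * a)
    | a + b <= d%:R * theta - z%:~R].
Proof.
have [q'_gt0 q'_lt K_gt0 det1 bE aE b_gt0 Kb_lt_a a_lt] := cv.
move=> hd; have [A [B [En ->]]] := cv_lattice d z; have b_lt_a := b_lt_a.
have [B2|B2|B0] := ltgtP B 0.
- have A1 : 1 <= A by nia.
  have B1 : B <= -1 by lia.
  have : 1 <= A%:~R :> R by rewrite (ler_int R 1).
  have : B%:~R <= -1 :> R by rewrite (ler_int R _ (-1)).
  by constructor 3; nra.
- have A0 : A <= 0 by nia.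
  have : A%:~R <= 0 :> R by rewrite (ler_int R _ 0).
  have [B1|B1] := eqVneq B 1.
    have A00 : A = 0 by nia.
    move: En; rewrite A00 B1 mul0r mul1r mul0r mul1r !add0r => -[En].
    by constructor 1.
  have : 2 <= B%:~R :> R by rewrite (ler_int R 2); lia.
  by constructor 2; nra.
- by exfalso; move: En; rewrite B0 mul0r addr0; have [|] := lerP A 0; nia.
Qed.

(** If [B >= 1] then [A <= K - 1], and [K b < a] makes [A b - B a] less than [- b]; otherwise
    [A >= 1]. *)
Lemma dist_lt_D (d : nat) (z : int) : (0 < d < D)%N ->
  d%:R * theta - z%:~R <= - b \/ b <= d%:R * theta - z%:~R.
Proof.
have [q'_gt0 q'_lt K_gt0 det1 bE aE b_gt0 Kb_lt_a a_lt] := cv.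
rewrite /D => hd; have [A [B [En ->]]] := cv_lattice d z; have b_lt_a := b_lt_a.
have [B2|B2|B0] := ltgtP B 0.
- have A1 : 1 <= A by nia.
  have B1 : B <= -1 by lia.
  have : 1 <= A%:~R :> R by rewrite (ler_int R 1).
  have : B%:~R <= -1 :> R by rewrite (ler_int R _ (-1)).
  by right; nra.
- have A0 : A + 1 <= K%:Z by nia.
  have : A%:~R + 1 <= K%:R :> R by move: A0; rewrite -(ler_int R) rmorphD /= -pmulrn.
  have : 1 <= B%:~R :> R by rewrite (ler_int R 1); lia.
  by left; nra.
- have A0 : 1 <= A by nia.
  have : 1 <= A%:~R :> R by rewrite (ler_int R 1).
  by right; rewrite B0; nra.
Qed.

(** The excluded shapes of [m] are the coefficients [B = 0] and [B = 1]. The exceptional last case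
    is [B = -1]. *)
Lemma dist_period (m : nat) (c : int) : (q < m < D)%N ->
  (forall t, m <> t * q)%N -> (forall l, m <> l * q + q')%N ->
  m%:R * theta - c%:~R <= - (a + b)
  \/ (a + b <= m%:R * theta - c%:~R /\
       (2 * (a + b) <= m%:R * theta - c%:~R \/
        exists t : nat, (m + q' = t.+1 * q)%N /\
          m%:R * theta - c%:~R = a + t.+1%:R * b)).
Proof.
have [q'_gt0 q'_lt K_gt0 det1 bE aE b_gt0 Kb_lt_a a_lt] := cv.
rewrite /D => hm nmul nsemi; have [A [B [En ->]]] := cv_lattice m c; have b_lt_a := b_lt_a.
have A0 : 0 <= A \/ 2 <= B by nia.
have nB0 : B <> 0.
  by move=> B0; apply: (nmul `|A|%N); rewrite B0 in En; nia.
have nB1 : B <> 1.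
  by move=> B1; apply: (nsemi `|A|%N); rewrite B1 in En A0; nia.
have [B2|B2] := lerP 2 B.
- have A1 : A + 1 <= K%:Z by nia.
  have : A%:~R + 1 <= K%:R :> R by move: A1; rewrite -(ler_int R) rmorphD /= -pmulrn.
  have : 2 <= B%:~R :> R by rewrite (ler_int R 2); lia.
  by left; nra.
have A2 : 2 <= A by nia.
have A2r : 2 <= A%:~R :> R by rewrite (ler_int R 2); lia.
have B1r : B%:~R <= -1 :> R by rewrite (ler_int R _ (-1)); lia.
right; split; first by nra.
have [B1|B1] := eqVneq B (-1).
- right; exists `|A|.-1%N; split; first by nia.
  have -> : (`|A|.-1.+1)%:R = A%:~R :> R by rewrite pmulrn; congr (_%:~R); lia.
  by rewrite B1 mulN1r opprK addrC.
- have : B%:~R <= -2 :> R by rewrite (ler_int R _ (-2)); lia.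
  by left; nra.
Qed.

End Convergents.

(** * Tilings of balanced sequences *)

Section Tilings.
Variable R : realType.

Definition dev (theta : R) (F : nat -> int) (i : nat) : R :=
  i%:R * theta - (F i)%:~R.

Definition balanced (theta : R) (F : nat -> int) : Prop :=
  forall i j, dev theta F i - dev theta F j < 1.

(* With [F] counting the 1's of a word of length [L]: [E] consecutive blocks of
   length [M] with [C] ones each, between a head of length [s < M] and a tail
   shorter than [M]. *)
Definition tiling (F : nat -> int) (L M : nat) (C : int) : Prop :=
  exists s E : nat,
    [/\ (s < M)%N, (0 < E)%N, (s + E * M <= L)%N, (L < s + E.+1 * M)%N
      & forall j, (j <= E)%N -> F (s + j * M)%N = F s + j%:Z * C].

Variables (theta : R) (q q' K : nat) (p p' : int) (a b : R) (F : nat -> int).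
Hypothesis cv : convergents theta q q' K p p' a b.
Hypothesis bal : balanced theta F.

Let D : nat := (K * q + q')%N.

Lemma devD (i d : nat) (z : int) :
  F (i + d)%N = F i + z -> dev theta F (i + d) = dev theta F i + (d%:R * theta - z%:~R).
Proof. by rewrite /dev => ->; rewrite natrD rmorphD /=; ring. Qed.

Lemma step_cases (i d : nat) (z : int) :
  0 < d%:R * theta - z%:~R -> d%:R * theta - z%:~R < 1 ->
  F (i + d)%N = F i + z \/ F (i + d)%N = F i + z + 1.
Proof.
move=> h0 h1; have Ez : F (i + d)%N = F i + (F (i + d)%N - F i) by rewrite addrC subrK.
have := bal (i + d) i; have := bal i (i + d).
rewrite (devD Ez); set y := F (i + d)%N - F i in Ez *.
move=> hlo hhi.
have : z%:~R - 1 < y%:~R :> R by lra.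
have : y%:~R < z%:~R + 2 :> R by lra.
rewrite -[2]/(2%:~R) -[1]/(1%:~R) -rmorphD -rmorphB !ltr_int; lia.
Qed.

Definition bad (i : nat) : bool := F (i + q)%N == F i + p + 1.

Lemma not_bad i : ~~ bad i -> F (i + q)%N = F i + p.
Proof.
have [q'_gt0 q'_lt K_gt0 det1 bE aE b_gt0 Kb_lt_a a_lt] := cv.
move=> nb; have hab := cv_ab_lt1 cv; have hba := b_lt_a cv.
have [//|h] : F (i + q)%N = F i + p \/ F (i + q)%N = F i + p + 1.
  by apply: step_cases; rewrite -bE; lra.
by rewrite /bad h eqxx in nb.
Qed.

Lemma dev_bad i : bad i -> dev theta F (i + q) = dev theta F i + b - 1.
Proof.
move/eqP; rewrite -addrA => /devD ->; rewrite (cv_bE cv) rmorphD /=; ring.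
Qed.

(** A bad step lands at [dev j + b - 1], and balance applies to that point: bad indices lie in a
    strip of width [b] at the top of the range. *)
Lemma dev_lt_bad i j : bad j -> dev theta F i - dev theta F j < b.
Proof. by move=> /dev_bad h; have := bal i (j + q); rewrite h; lra. Qed.

(** Deviations of two bad indices differ by less than [b], which [dist_lt_D] forbids at smaller
    distances. *)
Lemma bad_gap i j : bad i -> bad j -> (i < j)%N -> (i + D <= j)%N.
Proof.
move=> bi bj ij; rewrite leqNgt; apply/negP => lt.
have := dev_lt_bad i bj; have := dev_lt_bad j bi.
have Ez : F (i + (j - i))%N = F i + (F j - F i) by rewrite subnKC 1?ltnW // addrC subrK.
have := devD Ez; rewrite subnKC 1?ltnW // => ->.
have /(dist_lt_D cv (F j - F i)) : (0 < j - i < K * q + q')%N by move: lt; rewrite /D; lia.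
by case; lra.
Qed.

(** The bad step drops to the bottom of the range. Each further [q]-step gains [b], and [D b < 1]
    keeps the next [D - 1] of them from starting in the top strip. *)
Lemma after_bad i j : bad i -> (0 < j <= D)%N -> F (i + j * q)%N = F i + j%:Z * p + 1.
Proof.
have [q'_gt0 q'_lt K_gt0 det1 bE aE b_gt0 Kb_lt_a a_lt] := cv.
move=> bi; elim: j => // -[_ _|j IH /andP[_ ltjD]].
  by rewrite !mul1n mul1r (eqP bi).
have {}IH := IH (ltnW ltjD).
have nb : ~~ bad (i + j.+1 * q).
  apply/negP => bj; have := dev_lt_bad i bj.
  move: IH; rewrite -addrA => /devD ->.
  rewrite intrD intrM natrM -pmulrn.
  have : j.+1%:R + 1 <= D%:R :> R by rewrite natr1 ler_nat.
  have := cv_Db_lt1 cv; rewrite -/D bE; rewrite bE in b_gt0; nra.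
have -> : (i + j.+2 * q = i + j.+1 * q + q)%N by lia.
by rewrite (not_bad nb) IH; lia.
Qed.

Lemma run_no_bad v n : (forall i, (i < n)%N -> ~~ bad (v + i * q)) ->
  forall i, (i <= n)%N -> F (v + i * q)%N = F v + i%:Z * p.
Proof.
move=> nb; elim=> [_|i IH lt]; first by rewrite mul0n addn0 mul0r addr0.
have -> : (v + i.+1 * q = v + i * q + q)%N by lia.
by rewrite not_bad ?nb // IH ?(ltnW lt) //; lia.
Qed.

Lemma free_class c : exists2 v, (v < q)%N &
  forall i, bad i -> (c <= i < c + q.-1 * D)%N -> (i %% q)%N <> v.
Proof.
have [q'_gt0 q'_lt K_gt0 _ _ _ _ _ _] := cv.
have q0 : (0 < q)%N by lia. have D0 : (0 < D)%N by rewrite /D; lia.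
have [|none] := boolP [exists v : 'I_q, [forall i : 'I_(c + q.-1 * D),
  ~~ [&& bad i, (c <= i)%N & (i %% q)%N == v]]].
  move=> /existsP[v /forallP h]; exists v => // i bi /andP[ci ib] /eqP iv.
  by have /negP := h (Ordinal ib); apply; rewrite /= bi ci iv.
exfalso; move: none; rewrite negb_exists => /forallP none.
have {}none (v : 'I_q) : {i : 'I_(c + q.-1 * D) | [&& bad i, (c <= i)%N & (i %% q)%N == v]}.
  apply: sigW; have := none v; rewrite negb_forall => /existsP[i].
  by rewrite negbK => h; exists i.
pose f v := sval (none v).
have fP v : [&& bad (f v), (c <= f v)%N & (f v %% q)%N == v] by exact: (svalP (none v)).
have fD v : ((f v - c) %/ D < q.-1)%N.
  by rewrite ltn_divLR //; have := ltn_ord (f v); have /and3P[_ + _] := fP v; lia.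
(* The window is cut into [q - 1] pieces of length [D], each with at most one bad index, so the [q]
   classes cannot all be hit. *)
have inj : injective (fun v => Ordinal (fD v)).
  move=> v w [] e; have /and3P[bv cv' /eqP ev] := fP v; have /and3P[bw cw /eqP ew] := fP w.
  have := divn_eq (f v - c) D; have := divn_eq (f w - c) D; rewrite e.
  have := ltn_pmod (f v - c) D0; have := ltn_pmod (f w - c) D0 => h1 h2 h3 h4.
  apply: val_inj; rewrite /= -ev -ew.
  have [lt|lt|-> //] := ltngtP (f v) (f w).
    by have := bad_gap bv bw lt; lia.
  by have := bad_gap bw bv lt; lia.
by have := leq_card _ inj; rewrite !card_ord; lia.
Qed.

Variables (t L : nat).
Hypothesis t_gt0 : (0 < t)%N.

(** Starting at [v + (l %% t) q], the steps of length [t q] pass exactly through [v + l q], after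
    which no whole block fits; [l0 <= l %% t] keeps the start inside the run. *)
Lemma tiling_of_run v l0 l z : (2 * (t * q) <= L)%N -> (v < q)%N ->
  (l0 <= l %% t)%N -> (L < v + l * q + t * q)%N ->
  (forall i, (l0 <= i <= l)%N -> F (v + i * q)%N = z + i%:Z * p) ->
  tiling F L (t * q) (t%:Z * p).
Proof.
move=> L2 vq l0l Ll run.
have lt := ltn_pmod l t_gt0; have le := leq_mod l t; have el := divn_eq l t.
have sM : (v + (l %% t) * q < t * q)%N by nia.
have M0 : (0 < t * q)%N by lia.
have eL := divn_eq (L - (v + (l %% t) * q)) (t * q).
have lL := ltn_pmod (L - (v + (l %% t) * q)) M0.
set s := (v + (l %% t) * q)%N in sM eL lL *.
set E := ((L - s) %/ (t * q))%N in eL *.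
have E1 : (0 < E)%N by nia.
have El : (E <= l %/ t)%N by rewrite leqNgt; apply/negP => h; nia.
exists s, E; split => //; [lia|rewrite mulSn; lia|].
move=> j jE.
have -> : (s + j * (t * q) = v + (l %% t + j * t) * q)%N by rewrite /s; ring.
rewrite /s !run; first by rewrite PoszD PoszM; ring.
  by lia.
by nia.
Qed.

Lemma tiling_or_bad : (2 * (t * q) <= L)%N ->
  tiling F L (t * q) (t%:Z * p) \/
  exists2 i, bad i & (i + t * q + q.-1 * D <= L)%N /\
    ((t * q <= i + q)%N \/ (D.-1 * q + t * q + i %% q <= L)%N).
Proof.
have [q'_gt0 q'_lt K_gt0 _ _ _ _ _ _] := cv => L2.
have q0 : (0 < q)%N by lia. have D0 : (0 < D)%N by rewrite /D; lia.
(* The window ends at [L - t q], the last possible start of a block. If the subtraction truncates,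
   it covers all indices up to there. *)
have [v vq free] := free_class ((L - t * q).+1 - q.-1 * D).
have [|nbad] := boolP [exists i : 'I_(L - t * q).+1, bad i && ((i %% q)%N == v)]; last first.
  left; set l := ((L - t * q - v) %/ q).+1.
  have e := divn_eq (L - t * q - v) q; have lm := ltn_pmod (L - t * q - v) q0.
  apply: (@tiling_of_run v 0 l (F v)) => //; first by rewrite /l; nia.
  move=> i /andP[_]; apply: run_no_bad => j jl.
  apply/negP => bj; move/negP: nbad; apply; apply/existsP.
  have jL : (v + j * q < (L - t * q).+1)%N by rewrite /l in jl; nia.
  exists (Ordinal jL); rewrite /= bj /=; apply/eqP.
  by rewrite addnC modnMDl modn_small.
move=> /existsP[i /andP[bi /eqP iv]].
have iL := ltn_ord i.
have iU : (i + t * q + q.-1 * D <= L)%N.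
  by rewrite leqNgt; apply/negP => h; apply: (free i bi) => //; lia.
have [|lt1] := leqP (t * q) (i + q); first by right; exists (val i) => //; split; [|left].
have [|lt2] := leqP (D.-1 * q + t * q + i %% q) L; first by right; exists (val i) => //; split; [|right].
(* Here [i = u q + v] comes early and [L] is bounded, so the long run after the bad step at [i]
   suffices. *)
left; have ei := divn_eq i q; rewrite iv in ei; move: (i %/ q)%N ei => u ei; rewrite iv in lt2.
have ut : (u.+1 < t)%N by rewrite -(ltn_pmul2r q0); lia.
(* Take [D - 1], raised if its residue modulo [t] is too small until the residue is [u + 1]; the run
   reaches [D + u]. *)
have [l [l0 l1 lt]] : exists l, [/\ (D.-1 <= l)%N, (l <= D + u)%N & (u.+1 <= l %% t)%N].
  have [h|h] := leqP u.+1 (D.-1 %% t); first by exists D.-1; split => //; lia.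
  exists (D.-1 + (u.+1 - D.-1 %% t))%N; split; [lia|lia|].
  rewrite {1}(divn_eq D.-1 t).
  have -> : (D.-1 %/ t * t + D.-1 %% t + (u.+1 - D.-1 %% t) = D.-1 %/ t * t + u.+1)%N by lia.
  by rewrite modnMDl modn_small.
apply: (@tiling_of_run v u.+1 l (F i - u%:Z * p + 1)) => //.
  have : (D.-1 * q <= l * q)%N by rewrite leq_mul2r l0 orbT.
  by lia.
move=> j /andP[uj jl].
have -> : (v + j * q = i + (j - u) * q)%N.
  have : (u * q <= j * q)%N by rewrite leq_mul2r ltnW ?orbT.
  by rewrite mulnBl; lia.
rewrite after_bad //; last by lia.
have -> : (j - u)%N%:Z = j%:Z - u%:Z by lia.
by ring.
Qed.

(** Only one block fits, and it may start at 0 or 1. If both steps wrapped, the deviations at 0 and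
    1 would differ by less than [t b < a], against [dist_lt_q] for [d = 1]. *)
Lemma tiling_short : (t <= K)%N -> (t * q < L < 2 * (t * q))%N ->
  tiling F L (t * q) (t%:Z * p).
Proof.
have [q'_gt0 q'_lt K_gt0 _ bE aE b_gt0 Kb_lt_a a_lt] := cv => tK /andP[Lgt Llt].
have hab := cv_ab_lt1 cv; have hba := b_lt_a cv.
have stepE : (t * q)%:R * theta - (t%:Z * p)%:~R = t%:R * b.
  by rewrite bE intrM natrM -pmulrn; ring.
have t1 : 1 <= t%:R :> R by rewrite ler1n.
have tb : t%:R * b < a by have : t%:R <= K%:R :> R by [rewrite ler_nat]; nra.
have M1 : (1 < t * q)%N by nia.
have exM i : (i < 2)%N -> F (i + t * q)%N = F i + t%:Z * p -> tiling F L (t * q) (t%:Z * p).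
  move=> i2 h; exists i, 1%N; rewrite mul1n; split => //; try lia.
  by case=> [|[|//]] _; rewrite ?mul0n ?mul1n ?addn0 ?mul0r ?addr0 ?mul1r.
have devM i : F (i + t * q)%N = F i + t%:Z * p + 1 ->
    dev theta F (i + t * q) = dev theta F i + t%:R * b - 1.
  by rewrite -addrA => /devD ->; rewrite -stepE intrD; ring.
have cases i : F (i + t * q)%N = F i + t%:Z * p \/ F (i + t * q)%N = F i + t%:Z * p + 1.
  by apply: step_cases; rewrite stepE; nra.
case: (cases 0%N) => [|/devM h0]; first exact: exM.
case: (cases 1%N) => [|/devM h1]; first exact: exM.
exfalso.
have := bal 1 (0 + t * q); have := bal 0 (1 + t * q); rewrite h0 h1.
have Ez : F (0 + 1)%N = F 0%N + (F 1%N - F 0%N) by rewrite addrC subrK.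
have := devD Ez; rewrite add0n => ->.
have /(dist_lt_q cv (F 1%N - F 0%N)) : (0 < 1 < q)%N by lia.
by case=> [[_ ->]||]; lra.
Qed.

End Tilings.

Local Open Scope nat_scope.
(* With [q = e + 1], [m = (t + 1) q - q'] and [D = K q + q']: excludes the periods
   [m] which move the deviation in the same direction as [q]. *)
Lemma same_direction_bound (e q' K t m : nat) : q' <= e -> 1 < e -> 0 < t ->
  m + q' = t.+1 * e.+1 -> e * t.+1 <= K + q' ->
  e.+2 * m + e.+1 <= 2 * (t * e.+1) + e * (K * e.+1 + q').
Proof.
move=> q'e e1 t0 mE eK.
have h1 : e.+2 * m + e.+2 * q' = e.+2 * t.+1 * e.+1 by rewrite -mulnDr mE mulnA.
have h2 : e * (e * t.+1) <= e * K + e * q' by rewrite -mulnDr leq_mul2l eK orbT.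
have h3 : e.+2 * t.+1 + 1 <= 2 * t + e * K + 2 * q'.
  case: e e1 q'e h1 h2 {mE eK} => [|[|n]] // _ q'e _ h2.
  have h4 : n * q' <= n * n.+2 by rewrite leq_mul2l q'e orbT.
  have h5 : n.+2 * 2 <= n.+2 * t.+1 by rewrite leq_mul2l ltnS t0 orbT.
  have : n * (n.+2 * 2) <= n * (n.+2 * t.+1) by rewrite leq_mul2l h5 orbT.
  by lia.
have := leq_mul h3 (leqnn e.+1).
lia.
Qed.
Local Open Scope ring_scope.

(* [lia] also preprocesses the inequalities between reals, at a prohibitive cost. *)
Ltac nlia :=
  repeat match goal with
  | H : is_true (@Order.lt _ _ _ _) |- _ => clear H
  | H : is_true (@Order.le _ _ _ _) |- _ => clear H
  | H : @eq (Real.sort _) _ _ |- _ => clear H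
  end; lia.

(** * From blocks of length [m] to blocks of length [t q] *)

Section Reduction.
Variable R : realType.
Variables (theta : R) (q q' K : nat) (p p' : int) (a b : R) (F : nat -> int).
Hypothesis cv : convergents theta q q' K p p' a b.
Hypothesis bal : balanced theta F.
Let D : nat := (K * q + q')%N.

Variables (L m : nat) (c : int).
Hypothesis m_bnd : (q < m < K * q + q')%N.
Hypothesis m_mul : forall t, m <> (t * q)%N.
Hypothesis m_semi : forall l, m <> (l * q + q')%N.
Let t := (m %/ q)%N.
Let r := (m %% q)%N.

Lemma quotient_facts :
  [/\ m = (t * q + r)%N, (0 < r < q)%N, (0 < t <= K)%N & (2 < q)%N].
Proof.
have [q'_gt0 q'_lt K_gt0 _ _ _ _ _ _] := cv.
have q0 : (0 < q)%N by lia.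
have e := divn_eq m q; have lr := ltn_pmod m q0; rewrite -/t -/r in e lr.
have r0 : (0 < r)%N.
  by rewrite lt0n; apply/eqP => h; apply: (m_mul (t := t)); rewrite {1}e h addn0.
have rq' : r <> q' by move=> h; apply: (m_semi (l := t)); rewrite {1}e h.
have /andP[m_gt m_lt] := m_bnd.
by split => //; [lia|nia|lia].
Qed.

(** Each block moves the deviation by at least [a + b], and [q (a + b)] exceeds [q a + q' b = 1].
    With [q - 1] blocks, upward motion is excluded by this area count or by
    [same_direction_bound]. *)
Lemma blocks_lt_q s e : (0 < e)%N ->
  F (s + e * m)%N = F s + e%:Z * c ->
  (e < q)%N /\ (e.+1 = q -> (2 * (t * q) + q.-1 * D < q.+1 * m + q)%N ->
    dev theta F (s + e * m) <= dev theta F s - e%:R * (a + b)).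
Proof.
have [q'_gt0 q'_lt K_gt0 _ bE aE b_gt0 Kb_lt_a a_lt] := cv.
have [em r0 tK q2] := quotient_facts; have area := cv_area cv; have hba := b_lt_a cv.
move=> e0 /(devD theta); rewrite intrM natrM -pmulrn => Ed.
have {}Ed : dev theta F (s + e * m) = dev theta F s + e%:R * (m%:R * theta - c%:~R).
  by rewrite Ed; ring.
have := bal s (s + e * m); have := bal (s + e * m) s; rewrite Ed.
have e1 : 1 <= e%:R :> R by rewrite ler1n.
have := dist_period cv c m_bnd m_mul m_semi; move: (m%:R * theta - c%:~R) => d dP hi lo.
have e0R : 0 <= e%:R :> R by lra.
have eq : (e < q)%N.
  rewrite ltnNge; apply/negP => qe.
  have qab : q%:R * (a + b) <= e%:R * (a + b).
    by rewrite ler_wpM2r ?ler_nat //; lra.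
  have q'b : q'%:R * b <= q%:R * b by rewrite ler_wpM2r ?ler_nat ?(ltW b_gt0) // ltnW.
  by case: dP => [dle|[dge _]]; [have := ler_wpM2l e0R dle|have := ler_wpM2l e0R dge]; lra.
split=> // eq1 hL.
have eqR : q%:R = e%:R + 1 :> R by rewrite natr1 eq1.
have q'e : q'%:R <= e%:R :> R by rewrite ler_nat; nlia.
rewrite eqR in area.
have q'b : q'%:R * b <= e%:R * b by rewrite ler_pM2r.
have ea : a <= e%:R * a by rewrite ler_peMl //; lra.
have eb : 0 < e%:R * b by rewrite mulr_gt0 //; lra.
case: dP => [dle|[_ [dge|[t1 [mt1 Ed1]]]]].
- by have := ler_wpM2l e0R dle; lra.
- by exfalso; have := ler_wpM2l e0R dge; lra.
exfalso.
have hK : (e * t1.+1 < K.+1 + q')%N.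
  by rewrite -(ltr_nat R) natrM natrD -(ltr_pM2r b_gt0); rewrite Ed1 in hi; lra.
rewrite /D in hL; have /andP[m_gt m_lt] := m_bnd; have tt1 : t1 = t.
  have q0 : (0 < q)%N by nlia.
  have : (t1.+1 * q < t.+2 * q)%N by rewrite !mulSn; nlia.
  have : (t * q < t1.+1 * q)%N by nlia.
  by rewrite !ltn_pmul2r //; nlia.
rewrite tt1 -eq1 in hK mt1 q'_lt q2; rewrite -eq1 /= in hL.
have := same_direction_bound (q' := q') (e := e) (K := K) (t := t) (m := m).
by nlia.
Qed.

(** The length bounds force [i < s < i + 2 q]. Then [dist_lt_q] applies to [s - i], or to
    [s - (i + q)] past the wrap, and no admissible deviation fits. *)
Lemma bad_late s i : bad q p F i -> (s < m)%N -> (t * q <= i + q)%N ->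
  (i + t * q + q.-1 * D <= L)%N -> (L < s + q * m)%N ->
  - a + (q.-1%:R - q'%:R) * b < dev theta F s - dev theta F i -> False.
Proof.
have [q'_gt0 q'_lt K_gt0 _ bE aE b_gt0 Kb_lt_a a_lt] := cv.
have [em r0 tK q2] := quotient_facts; have hba := b_lt_a cv; have hab := cv_ab_lt1 cv.
move=> bi sm ti iL Ls lo; have hi := dev_lt_bad cv bal s bi.
have /andP[m_gt m_lt] := m_bnd; rewrite -/D in m_lt.
have mD : (q.-1 * m + q.-1 <= q.-1 * D)%N by rewrite addnC -mulnS leq_mul2l m_lt orbT.
have qm : (q * m = q.-1 * m + m)%N by rewrite -[in LHS](ltn_predK q2) mulSn addnC.
have pb : 0 <= (q.-1%:R - q'%:R) * b.
  by apply: mulr_ge0 (ltW b_gt0); rewrite subr_ge0 ler_nat; nlia.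
have is' : (i < s)%N by nlia.
have [ds|ds] := ltnP (s - i) q.
  have Ez : F (i + (s - i))%N = F i + (F s - F i) by rewrite subnKC 1?ltnW // addrC subrK.
  have := devD theta Ez; rewrite subnKC 1?ltnW // => Es; rewrite Es in lo hi.
  have /(dist_lt_q cv (F s - F i)) : (0 < s - i < q)%N by nlia.
  by case=> [[_ E]|E|E]; lra.
have devq := dev_bad cv bi.
have [es|ns] := eqVneq s (i + q)%N.
  by rewrite es devq in lo; lra.
have siq : (i + q <= s)%N by nlia.
have Ez : F (i + q + (s - (i + q)))%N = F (i + q)%N + (F s - F (i + q)%N).
  by rewrite subnKC // addrC subrK.
have := devD theta Ez; rewrite subnKC // => Es; rewrite Es devq in lo hi.
have /(dist_lt_q cv (F s - F (i + q)%N + 1)) : (0 < s - (i + q) < q)%N by nlia.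
rewrite intrD; case=> [[dq' E]|E|E]; [|by lra|by lra].
(* Here [q' = s - (i + q) < r < q], so the surplus in the lower bound is at least one whole [b]. *)
have pb1 : 1 * b <= (q.-1%:R - q'%:R) * b.
  by rewrite ler_pM2r // lerBrDr addrC natr1 ler_nat; nlia.
lra.
Qed.

(** The length bounds force [m = D - 1], hence [r = q' - 1]. Following the run after [i] up to
    [t q + v] leaves a distance to [s] below [q'], too short for the deviation observed. *)
Lemma bad_early s i : bad q p F i -> (s < m)%N -> (i + q < t * q)%N ->
  (D.-1 * q + t * q + i %% q <= L)%N -> (L < s + q * m)%N ->
  - a < dev theta F s - dev theta F i -> False.
Proof.
have [q'_gt0 q'_lt K_gt0 _ bE aE b_gt0 Kb_lt_a a_lt] := cv.
have [em r0 tK q2] := quotient_facts; have hba := b_lt_a cv; have hab := cv_ab_lt1 cv.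
move=> bi sm ti iL Ls lo; have hi := dev_lt_bad cv bal s bi.
have /andP[m_gt m_lt] := m_bnd; rewrite -/D in m_lt.
have mD : m = D.-1.
  apply/eqP; rewrite eqn_leq; apply/andP; split; first by nlia.
  rewrite leqNgt; apply/negP => h.
  have : (m.+1 * q <= D.-1 * q)%N by rewrite leq_mul2r h orbT.
  by rewrite mulSn [(m * q)%N]mulnC; nlia.
have q'1 : (1 < q')%N.
  rewrite ltn_neqAle q'_gt0 andbT; apply/eqP => q'1.
  by apply: (m_mul (t := K)); rewrite mD /D -q'1 addn1.
have q0 : (0 < q)%N by nlia.
have rE : r = q'.-1.
  rewrite /r mD /D -(ltn_predK q'1) addnS /= modnMDl modn_small //; nlia.
have iq := divn_eq i q; set u := (i %/ q)%N in iq; set v := (i %% q)%N in iq iL.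
have vq : (v < q)%N by rewrite ltn_pmod.
have ut : (u.+1 < t)%N by rewrite -(ltn_pmul2r q0) mulSn; nlia.
have [j [jE j0 jK]] : exists j, [/\ (t = u + j)%N, (0 < j)%N & (j <= K)%N].
  by exists (t - u)%N; split; nlia.
have ij : (i + j * q = t * q + v)%N by rewrite jE mulnDl; nlia.
have KD : (K <= D)%N by rewrite (leq_trans _ (leq_addr _ _)) ?leq_pmulr.
have Fj : F (i + j * q)%N = F i + j%:Z * p + 1.
  by apply: (after_bad cv bal) => //; rewrite j0 -/D (leq_trans jK).
have devj : dev theta F (i + j * q) = dev theta F i + j%:R * b - 1.
  move: Fj; rewrite -addrA => /(devD theta) ->.
  by rewrite intrD intrM natrM -pmulrn bE; ring.
have sl : (t * q + v < s)%N.
  by rewrite mD mulnC in Ls; nlia.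
have sv : (i + j * q <= s)%N by nlia.
have Ez : F (i + j * q + (s - (i + j * q)))%N = F (i + j * q)%N + (F s - F (i + j * q)%N).
  by rewrite subnKC // addrC subrK.
have := devD theta Ez; rewrite subnKC // => Es; rewrite Es devj in lo hi.
have sd : (0 < s - (i + j * q) < q')%N by nlia.
have jb : j%:R * b <= K%:R * b by rewrite ler_pM2r // ler_nat.
have jb0 : 0 <= j%:R * b by rewrite mulr_ge0 // ltW.
have /(dist_lt_q cv (F s - F (i + j * q)%N + 1)) : (0 < s - (i + j * q) < q)%N by nlia.
by rewrite intrD; case=> [[dq' E]|E|E]; [nlia|lra|lra].
Qed.

Lemma tiling_reduction : tiling F L m c -> tiling F L (t * q) (t%:Z * p).
Proof.
have [q'_gt0 q'_lt K_gt0 _ bE aE b_gt0 Kb_lt_a a_lt] := cv.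
have [em r0 tK q2] := quotient_facts.
have /andP[t0 tleK] := tK; have /andP[m_gt m_lt] := m_bnd; rewrite -/D in m_lt.
move=> [s [e [sm e0 seL Lse run]]].
have mL : (m <= L)%N by have : (1 * m <= e * m)%N by [rewrite leq_mul2r e0 orbT]; nlia.
have [Lshort|Llong] := ltnP L (2 * (t * q)).
  by apply: (tiling_short cv bal t0 tleK); nlia.
have [//|[i bi [iU iC]]] := tiling_or_bad cv bal t0 Llong.
exfalso; rewrite -/D in iU iC.
have [eq down] := blocks_lt_q e0 (run e (leqnn e)).
have mD : (q.-1 * m + q.-1 <= q.-1 * D)%N by rewrite addnC -mulnS leq_mul2l m_lt orbT.
have qm : (q * m = q.-1 * m + m)%N by rewrite -[in LHS](ltn_predK q2) mulSn addnC.
have tq : (1 * q <= t * q)%N by rewrite leq_mul2r t0 orbT.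
have qD : (D.-1 * q = q.-1 * D + D - q)%N.
  by rewrite -subn1 mulnBl mul1n [(D * q)%N]mulnC -[in LHS](ltn_predK q2) mulSn; nlia.
(* Both outcomes of [tiling_or_bad] make [L] so large that fewer than [q - 1] blocks of length [m]
   cannot fill it. *)
have key : (2 * (t * q) + q.-1 * D < L + q.+1)%N by case: iC => h; nlia.
have eqq : e.+1 = q.
  apply/eqP; rewrite eqn_leq eq leqNgt; apply/negP => h.
  have : (e.+1 * m <= q.-1 * m)%N by rewrite leq_mul2r; apply/orP; right; nlia.
  by nlia.
have {}down := down eqq; have {}down : dev theta F (s + e * m) <= dev theta F s - e%:R * (a + b).
  by apply: down; rewrite mulSn -eqq in Lse *; nlia.
have up := bal i (s + e * m).
have area := cv_area cv; rewrite -eqq -natr1 in area.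
(* Balance between [i] and the end of the last block gives [e (a + b) - 1], and 1 is replaced by
   [q a + q' b]. *)
have lo : - a + (q.-1%:R - q'%:R) * b < dev theta F s - dev theta F i.
  by rewrite -eqq /=; lra.
have Ls : (L < s + q * m)%N by rewrite -eqq.
have [h|h] := leqP (t * q) (i + q); first exact: (bad_late bi sm h iU Ls lo).
case: iC => [|h2]; first by rewrite leqNgt h.
apply: (bad_early bi sm h h2 Ls); apply: le_lt_trans lo.
by rewrite lerDl mulr_ge0 ?(ltW b_gt0) // subr_ge0 ler_nat; nlia.
Qed.

End Reduction.

(** * Abelian periods of binary words *)

Section Words.
Variables (x : nat -> nat).
Hypothesis x01 : forall j, (x j <= 1)%N.

Definition nones (u : seq nat) : nat := count (pred1 1%N) u.

Lemma nones_cat u v : nones (u ++ v) = (nones u + nones v)%N.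
Proof. exact: count_cat. Qed.

Definition ones (i : nat) : nat := nones (mkseq x i).

Lemma ones_le_size (u : seq nat) : (nones u <= size u)%N.
Proof. exact: count_size. Qed.

Lemma parikhE (u : seq nat) : all (fun l => l <= 1)%N u ->
  parikh u = (size u - nones u, nones u)%N.
Proof.
rewrite /parikh /nones => u01; congr pair; elim: u u01 => //= l u IH /andP[l1 /IH ->].
by have := ones_le_size u; rewrite /nones; case: l l1 => [|[|//]] _ /=; lia.
Qed.

Lemma all01_mkseq n : all (fun l => l <= 1)%N (mkseq x n).
Proof. by apply/allP => _ /mapP[j _ ->]; exact: x01. Qed.

Lemma take_mkseq i n : (i <= n)%N -> take i (mkseq x n) = mkseq x i.
Proof. by move=> h; rewrite /mkseq -map_take take_iota (minn_idPl h). Qed.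

Lemma ones_factor n i d : (i + d <= n)%N ->
  (nones (take d (drop i (mkseq x n))) + ones i = ones (i + d))%N.
Proof.
move=> h; rewrite /ones -(take_mkseq h) takeD nones_cat addnC.
by rewrite take_mkseq // (leq_trans (leq_addr _ _) h).
Qed.

Lemma pcontained_size (u v : seq nat) : all (fun l => l <= 1)%N u ->
  all (fun l => l <= 1)%N v -> pcontained (parikh u) (parikh v) -> (size u < size v)%N.
Proof.
move=> hu hv; rewrite !parikhE // => /and3P[/= h1 h2 /eqP ne].
rewrite ltnNge; apply/negP => vu; apply: ne.
have := ones_le_size u; have := ones_le_size v => cv cu.
have -> : nones u = nones v by lia.
by have -> : size u = size v by lia.
Qed.

(** Of the containment of head and tail, only their being shorter than a block is kept. *)
Lemma tiling_of_abelian_period L m : abelian_period (mkseq x L) m ->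
  exists c : nat, tiling (fun i => (ones i)%:Z) L m c%:Z.
Proof.
move=> [u0 [un [us [P [us0 ew /allP hus h0 hn]]]]].
have sizes j : (j <= size us)%N -> size (flatten (take j us)) = (j * m)%N /\
    nones (flatten (take j us)) = (j * P.2)%N.
  elim: j => [|j IH] hj; first by rewrite take0 /=.
  have [IHs IHc] := IH (ltnW hj).
  have hin : nth [::] us j \in us by rewrite mem_nth.
  have /andP[/eqP hP /eqP hm] := hus _ hin.
  rewrite (take_nth [::]) // -cats1 flatten_cat /= cats0 size_cat nones_cat IHs IHc hm -[nones (nth _ _ _)]/(parikh (nth [::] us j)).2 hP.
  by rewrite !mulSn; split; lia.
have all01 := all01_mkseq L; rewrite ew !all_cat in all01.
have /and3P[a0 aus an] := all01.
have [v vin] : exists v, v \in us by case: us us0 {ew hus sizes all01 aus} => // v us _; exists v; rewrite mem_head.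
have /andP[/eqP hP /eqP hm] := hus v vin.
have av : all (fun l => l <= 1)%N v.
  apply/allP => l lv; apply: (allP aus); apply/flattenP; by exists v.
rewrite -hP in h0 hn.
have s0 := pcontained_size a0 av h0; have sn := pcontained_size an av hn; rewrite hm in s0 sn.
have [sz _] := sizes _ (leqnn (size us)); rewrite take_size in sz.
have eL : L = (size u0 + size us * m + size un)%N.
  by have := congr1 size ew; rewrite size_mkseq !size_cat sz addnA.
exists P.2, (size u0), (size us); split => //.
- by rewrite lt0n size_eq0.
- by rewrite eL leq_addr.
- by rewrite eL mulSn; lia.
have count_pre j : (j <= size us)%N ->
    ones (size u0 + j * m) = (nones u0 + j * P.2)%N.
  move=> hj; have [szj cj] := sizes j hj.
  have le : (size u0 + j * m <= L)%N.
    by rewrite eL -addnA leq_add2l (leq_trans _ (leq_addr _ _)) // leq_mul2r hj orbT.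
  rewrite /ones -(take_mkseq le) ew -{1}(cat_take_drop j us) flatten_cat -catA catA.
  by rewrite take_size_cat ?size_cat ?szj // nones_cat cj.
move=> j hj; rewrite count_pre //.
by have := count_pre 0%N (leq0n _); rewrite mul0n addn0 addn0 => ->; rewrite PoszD PoszM.
Qed.

(** The second hypothesis bounds the ones and the zeros of every factor shorter than [M], so head
    and tail are contained in a block. *)
Lemma abelian_period_of_tiling L M (C : int) :
  tiling (fun i => (ones i)%:Z) L M C ->
  (forall i d, (d < M)%N ->
     (ones (i + d))%:Z - (ones i)%:Z <= C /\
     d%:Z - ((ones (i + d))%:Z - (ones i)%:Z) <= M%:Z - C) ->
  abelian_period (mkseq x L) M.
Proof.
move=> [s [E [sM E0 sEL LsE run]]] short.
have M0 : (0 < M)%N by lia.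
set w := mkseq x L; have szw : size w = L by rewrite size_mkseq.
have blk j : (j < E)%N -> (nones (take M (drop (s + j * M) w)))%:Z = C.
  move=> jE.
  have le : (s + j * M + M <= L)%N.
    have : (j.+1 * M <= E * M)%N by rewrite leq_mul2r jE orbT.
    by rewrite mulSn; lia.
  have := ones_factor le; have /= := run j (ltnW jE); have /= := run j.+1 jE; rewrite -/w.
  have -> : (s + j.+1 * M = s + j * M + M)%N by rewrite mulSn; lia.
  have -> : j.+1%:Z * C = j%:Z * C + C by rewrite -addn1 PoszD mulrDl mul1r.
  by lia.
have EM : (M <= E * M)%N by rewrite leq_pmull.
have C0 := blk 0%N E0.
have CM := ones_le_size (take M (drop (s + 0 * M) w)).
set c := nones _ in C0 CM.
have {}CM : (c <= M)%N by rewrite (leq_trans CM) // size_take_min geq_minl.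
have szb j : (j < E)%N -> size (take M (drop (s + j * M) w)) = M.
  move=> jE; have : (j.+1 * M <= E * M)%N by rewrite leq_mul2r jE orbT.
  by rewrite mulSn => h; rewrite size_takel // size_drop szw; lia.
have sub01 i d : all (fun l => l <= 1)%N (take d (drop i w)).
  by apply/allP => l /mem_take /mem_drop lw; apply: (allP (all01_mkseq L)).
have fact i d : (i + d <= L)%N -> (d < M)%N -> pcontained (parikh (take d (drop i w))) (M - c, c)%N.
  move=> le dM; have [h1 h2] := short i d dM; have h := ones_factor le.
  have szd : size (take d (drop i w)) = d by rewrite size_takel // size_drop szw; lia.
  have cd := ones_le_size (take d (drop i w)).
  rewrite szd -/w in h cd.
  rewrite parikhE // szd; apply/and3P; split; [by rewrite /=; lia|by rewrite /=; lia|].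
  by apply/eqP => -[]; lia.
exists (take s w), (drop (s + E * M) w), [seq take M (drop (s + j * M) w) | j <- iota 0 E].
exists (M - c, c)%N; split.
- by case: E E0 {sEL LsE run blk EM szb}.
- have -> : flatten [seq take M (drop (s + j * M) w) | j <- iota 0 E] = take (E * M) (drop s w).
    elim: (E) => [|n IH]; first by rewrite mul0n take0.
    rewrite -addn1 iotaD map_cat flatten_cat IH /= cats0 add0n.
    by rewrite mulnDl mul1n takeD drop_drop addnC.
  by rewrite [(s + E * M)%N]addnC -drop_drop !cat_take_drop.
- apply/allP => _ /mapP[j + ->]; rewrite mem_iota /= add0n => jE.
  rewrite szb // eqxx andbT; apply/eqP.
  rewrite parikhE // szb //.
  by have := blk j jE; rewrite -C0 => -[->].
- by have := fact 0%N s; rewrite add0n drop0; apply=> //; lia.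
- have := fact (s + E * M)%N (L - (s + E * M))%N.
  rewrite (take_oversize (n := L - _)) ?size_drop ?szw //; apply; first by lia.
  by move: LsE; rewrite mulSn; lia.
Qed.

End Words.

(** * Sturmian words and continued fractions *)

Section Sturmian.
Variable R : realType.

Lemma fracp_itv (x : R) : 0 <= fracp x < 1.
Proof.
have /andP[h1 h2] := floor_itv x; rewrite /fracp; rewrite intrD in h2.
by apply/andP; split; lra.
Qed.

Lemma fracpE (x y : R) (n : int) : 0 <= y < 1 -> x = y + n%:~R -> fracp x = y.
Proof.
move=> /andP[y0 y1] ->; rewrite /fracp (@floor_def _ _ n) ?addrK //.
by rewrite intrD; apply/andP; split; lra.
Qed.

Lemma fracpD (x alpha : R) : 0 < alpha < 1 ->
  fracp (x + alpha) = fracp x + alpha - (if fracp x < 1 - alpha then 0 else 1).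
Proof.
move=> /andP[a0 a1]; have /andP[f0 f1] := fracp_itv x.
have xE : x = fracp x + (Num.floor x)%:~R by rewrite /fracp subrK.
case: ltP => h.
  apply: (@fracpE _ _ (Num.floor x)); first by apply/andP; split; lra.
  by rewrite [in LHS]xE; ring.
apply: (@fracpE _ _ (Num.floor x + 1)); first by apply/andP; split; lra.
by rewrite [in LHS]xE intrD; ring.
Qed.

Lemma fracpN (x : R) : fracp (- x) = if fracp x == 0 then 0 else 1 - fracp x.
Proof.
have /andP[f0 f1] := fracp_itv x.
have xE : x = fracp x + (Num.floor x)%:~R by rewrite /fracp subrK.
case: eqVneq => h.
  by apply: (@fracpE _ _ (- Num.floor x)); rewrite ?lexx ?ltr01 // [in LHS]xE h intrN; ring.
have f0' : 0 < fracp x by rewrite lt_neqAle eq_sym h.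
apply: (@fracpE _ _ (- Num.floor x - 1)); first by apply/andP; split; lra.
by rewrite [in LHS]xE intrD !intrN; ring.
Qed.

(** The reflection of the circle turns the intervals closed on the right into ones closed on the
    left, so it handles the second convention. *)
Lemma fracpNB (x alpha : R) : 0 < alpha < 1 ->
  fracp (- (x + alpha)) =
  fracp (- x) - alpha + (if (0 < fracp x) && (fracp x <= 1 - alpha) then 0 else 1).
Proof.
move=> ha; have /andP[a0 a1] := ha; have /andP[f0 f1] := fracp_itv x.
rewrite !fracpN fracpD //; case: (ltgtP (fracp x) (1 - alpha)) => h /=.
- rewrite subr0 gt_eqF; last by lra.
  have [e|ne] := eqVneq (fracp x) 0; first by rewrite e ltxx /=; lra.
  by rewrite lt_neqAle eq_sym ne f0 /=; lra.
- rewrite andbF (gt_eqF (lt_trans _ h)); last by lra.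
  rewrite gt_eqF; last by lra.
  by lra.
- have -> : fracp x + alpha - 1 = 0 by lra.
  by rewrite eqxx h gt_eqF; last lra; rewrite (_ : 0 < 1 - alpha) /=; lra.
Qed.

Lemma sturmian_le1 conv (alpha rho : R) n : (sturmian conv alpha rho n <= 1)%N.
Proof. by rewrite /sturmian; case: ifP. Qed.

Lemma onesS (x : nat -> nat) i : (x i <= 1)%N -> ones x i.+1 = (ones x i + x i)%N.
Proof.
rewrite /ones mkseqS -cats1 nones_cat => xi; congr addn.
by rewrite /nones /=; case: (x i) xi => [|[|]].
Qed.

Lemma dev_onesS (x : nat -> nat) (alpha : R) i : (x i <= 1)%N ->
  dev alpha (fun i => (ones x i)%:Z) i.+1 =
  dev alpha (fun i => (ones x i)%:Z) i + alpha - (x i)%:R.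
Proof. by move=> /onesS h; rewrite /dev h -natr1 PoszD intrD -!pmulrn; ring. Qed.

(** The deviation is the displacement of the rotating point (reflected for the second convention) in
    [[0, 1)]: a letter 1 marks each wrap. *)
Lemma sturmian_balanced conv (alpha rho : R) i0 : 0 < alpha < 1 ->
  balanced alpha (fun i => (ones (fun j => sturmian conv alpha rho (i0 + j)) i)%:Z).
Proof.
move=> ha; pose x j := sturmian conv alpha rho (i0 + j); rewrite -/x.
pose y i := rho + (i0 + i)%:R * alpha.
have yS i : y i.+1 = y i + alpha by rewrite /y addnS -natr1; ring.
have dev0 : dev alpha (fun i => (ones x i)%:Z) 0%N = 0.
  by rewrite /dev mul0r sub0r /ones /= oppr0.
case: conv @x dev0 => x dev0.
- have devE i : dev alpha (fun i => (ones x i)%:Z) i = fracp (- y 0%N) - fracp (- y i).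
    elim: i => [|i IH]; first by rewrite dev0 subrr.
    rewrite dev_onesS ?sturmian_le1 // IH yS fracpNB // /x /sturmian /in_I0 -/(y i).
    by case: ifP => _; ring.
  move=> i j; rewrite !devE.
  by have := fracp_itv (- y i); have := fracp_itv (- y j); lra.
- have devE i : dev alpha (fun i => (ones x i)%:Z) i = fracp (y i) - fracp (y 0%N).
    elim: i => [|i IH]; first by rewrite dev0 subrr.
    rewrite dev_onesS ?sturmian_le1 // IH yS fracpD // /x /sturmian /in_I0 -/(y i).
    by have /andP[-> _] := fracp_itv (y i); rewrite /=; case: ifP => _; ring.
  move=> i j; rewrite !devE.
  by have := fracp_itv (y i); have := fracp_itv (y j); lra.
Qed.

Lemma balancedN (alpha : R) (F : nat -> int) :
  balanced alpha F -> balanced (- alpha) (fun i => - F i).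
Proof.
move=> bal i j; have := bal j i; rewrite /dev !intrN; lra.
Qed.

Lemma tilingN (F : nat -> int) L M C : tiling F L M C -> tiling (fun i => - F i) L M (- C).
Proof.
move=> [s [E [h1 h2 h3 h4 run]]]; exists s, E; split => // j jE.
by rewrite run // opprD mulrN.
Qed.

(** Balance gives fewer than [d alpha + 1 <= (M - 1) alpha + 1 <= C + 1] ones; zeros are counted
    likewise with [1 - alpha]. *)
Lemma short_block (alpha : R) (F : nat -> int) (M : nat) (C : int) :
  0 < alpha < 1 -> balanced alpha F ->
  - (1 - alpha) <= M%:R * alpha - C%:~R <= alpha ->
  forall i d, (d < M)%N ->
    F (i + d)%N - F i <= C /\ d%:Z - (F (i + d)%N - F i) <= M%:Z - C.
Proof.
move=> /andP[a0 a1] bal /andP[lo hi] i d dM.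
have b1 := bal i (i + d)%N; have b2 := bal (i + d)%N i.
rewrite /dev natrD in b1 b2.
have Md : d%:R + 1 <= M%:R :> R by rewrite natr1 ler_nat.
have Mda := ler_wpM2r (ltW a0) Md.
have Mda' : (d%:R + 1) * (1 - alpha) <= M%:R * (1 - alpha) by apply: ler_wpM2r => //; lra.
split; rewrite -ltzD1 -(ltr_int R) !(intrD, intrN) -?pmulrn; lra.
Qed.

(** * Convergents from the Gauss map *)

Section ContinuedFraction.
Variable alpha : R.
Hypothesis alpha_itv : 0 < alpha < 2^-1.
Hypothesis alpha_irr : irrational alpha.

Lemma irrational_neq (theta : R) (n : nat) (z : int) :
  theta = alpha \/ theta = - alpha -> (0 < n)%N -> n%:R * theta - z%:~R != 0.
Proof.
move=> ht n0; apply/negP; rewrite subr_eq0 => /eqP h; apply: alpha_irr; apply/rationalP.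
have n0R : n%:R != 0 :> R by rewrite pnatr_eq0 -lt0n.
case: ht => ht; rewrite ht in h.
- by exists z, n; rewrite -h mulrC mulKf.
- by exists (- z), n; rewrite intrN -h mulrN opprK mulrC mulKf.
Qed.

(** One step of the Euclidean algorithm on [(a, b)]: the partial quotient is the floor of
    [a / b]. *)
Lemma cf_stepP (k : nat) (a b : R) : 0 < b -> b < a -> gauss alpha k = b / a ->
  [/\ (0 < cf_a alpha k.+1)%N, (cf_a alpha k.+1)%:R * b <= a,
      a < (cf_a alpha k.+1).+1%:R * b
    & gauss alpha k.+1 = (a - (cf_a alpha k.+1)%:R * b) / b].
Proof.
move=> b0 ba gE; have a0 := lt_trans b0 ba.
have giE : (gauss alpha k)^-1 = a / b by rewrite gE invf_div.
have ab1 : 1 < a / b by rewrite ltr_pdivlMr // mul1r.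
have ab0 : 0 <= a / b by lra.
have /andP[lo hi] := truncn_itv ab0.
rewrite /= giE; split.
- by rewrite truncn_ge_nat // ltW.
- by rewrite -ler_pdivlMr.
- by rewrite -ltr_pdivrMr.
apply: (@fracpE _ _ (Num.truncn (a / b))%:Z); last first.
  by rewrite -pmulrn mulrBl mulfK ?subrK // gt_eqF.
rewrite mulrBl mulfK ?gt_eqF // -natr1 in hi *.
by apply/andP; split; lra.
Qed.

Lemma cf_pack (k : nat) (theta : R) (p p' : int) (a b : R) :
  theta = alpha \/ theta = - alpha ->
  (0 < cf_q alpha k)%N -> (cf_q alpha k < cf_q alpha k.+1)%N ->
  (cf_q alpha k.+1)%:Z * p' - (cf_q alpha k)%:Z * p = 1 ->
  b = (cf_q alpha k.+1)%:R * theta - p%:~R ->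
  a = p'%:~R - (cf_q alpha k)%:R * theta -> 0 < b -> b < a ->
  gauss alpha k.+1 = b / a ->
  convergents theta (cf_q alpha k.+1) (cf_q alpha k) (cf_a alpha k.+2) p p' a b.
Proof.
move=> ht q0 qq det bE aE b0 ba gE; have [K0 Klo Khi _] := cf_stepP b0 ba gE.
split=> //; rewrite lt_neqAle Klo andbT.
set K := cf_a alpha k.+2 in K0 Klo Khi *.
have D0 : (0 < K * cf_q alpha k.+1 + cf_q alpha k)%N by rewrite addn_gt0 q0 orbT.
have := irrational_neq (K%:Z * p + p') ht D0; apply: contra => /eqP e.
by rewrite natrD natrM intrD intrM -pmulrn; apply/eqP; rewrite aE bE in e; lra.
Qed.

Lemma cf_convergents (k : nat) : exists (theta : R) (p p' : int) (a b : R),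
  [/\ theta = alpha \/ theta = - alpha,
      convergents theta (cf_q alpha k.+1) (cf_q alpha k) (cf_a alpha k.+2) p p' a b
    & gauss alpha k.+1 = b / a].
Proof.
have /andP[al0 al2] := alpha_itv.
elim: k => [|k [theta [p [p' [a [b [ht cv gE]]]]]]].
- have half : (2^-1 : R) < 1 by lra.
  have al1 : alpha < 1 by lra.
  have g0 : gauss alpha 0 = alpha / 1 by rewrite divr1.
  have [K0 Klo Khi g1] := cf_stepP al0 al1 g0.
  have ht : - alpha = alpha \/ - alpha = - alpha by right.
  (* This is where [alpha < 1/2] enters: it makes [q_0 < q_1] strict. *)
  have q1 : (1 < cf_a alpha 1)%N.
    rewrite ltnNge; apply/negP => K1.
    have : (cf_a alpha 1).+1%:R <= 2 :> R by rewrite ler_nat.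
    by nra.
  have Klt : (cf_a alpha 1)%:R * alpha < 1.
    rewrite lt_neqAle Klo andbT -subr_eq0.
    exact: (irrational_neq 1 (or_introl erefl) K0).
  exists (- alpha), (-1), 0, alpha, (1 - (cf_a alpha 1)%:R * alpha).
  split => //; apply: cf_pack => //.
  + by rewrite mulr0.
  + by rewrite [cf_q alpha 1]/(cf_a alpha 1) intrN; ring.
  + by rewrite /= mul1r; ring.
  + by rewrite subr_gt0.
  + by move: Khi; rewrite -natr1; lra.
have [q'_gt0 q'_lt K_gt0 det1 bE aE b_gt0 Kb_lt_a a_lt] := cv.
have hba := b_lt_a cv.
have [K0 Klo Khi g1] := cf_stepP b_gt0 hba gE.
set K := cf_a alpha k.+2 in K0 Klo Khi g1 cv K_gt0 Kb_lt_a a_lt *.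
have ht' : - theta = alpha \/ - theta = - alpha.
  by case: ht => ->; [right|left; rewrite opprK].
exists (- theta), (- (K%:Z * p + p')), (- p), b, (a - K%:R * b).
split=> //; apply: cf_pack => //.
- exact: leq_ltn_trans q'_lt.
- rewrite [cf_q alpha k.+2]/(K * cf_q alpha k.+1 + cf_q alpha k)%N.
  by rewrite -addn1 leq_add // leq_pmull.
- rewrite [cf_q alpha k.+2]/(K * cf_q alpha k.+1 + cf_q alpha k)%N PoszD PoszM.
  by rewrite -[RHS]det1; ring.
- rewrite [cf_q alpha k.+2]/(K * cf_q alpha k.+1 + cf_q alpha k)%N natrD natrM.
  by rewrite intrN intrD intrM -pmulrn aE bE; ring.
- by rewrite intrN bE; ring.
- by lra.
- by move: Khi; rewrite -natr1; lra.
Qed.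

Lemma cf_q_gt (n : nat) : (n < cf_q alpha n)%N.
Proof.
elim: n => // n IH; have [theta [p [p' [a [b [_ cv _]]]]]] := cf_convergents n.
by apply: leq_ltn_trans (cv_q'_lt cv).
Qed.

End ContinuedFraction.

(** * Minimal abelian periods of Sturmian factors *)

Lemma convergents_alpha_itv (alpha theta : R) q q' K p p' (a b : R) :
  0 < alpha < 1 -> theta = alpha \/ theta = - alpha ->
  convergents theta q q' K p p' a b -> a <= alpha <= 1 - a.
Proof.
move=> /andP[a0 a1] ht cv; have [q'_gt0 q'_lt _ _ _ _ b_gt0 _ _] := cv.
have hba := b_lt_a cv.
(* The approximation bound for [d = 1] keeps [alpha] at distance at least [a] from 0 and from 1. *)
have q1 : (0 < 1 < q)%N by apply: leq_ltn_trans q'_lt.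
have h0 := dist_lt_q cv 0 q1; have h1 := dist_lt_q cv 1 q1.
have hN1 := dist_lt_q cv (-1) q1.
rewrite !mul1r !(intrN _ 1) ?mulr0z ?mulr1z in h0 h1 hN1.
apply/andP; case: ht => ht; rewrite ht in h0 h1 hN1; split.
- by case: h0 => [[_ ?]|?|?]; lra.
- by case: h1 => [[_ ?]|?|?]; lra.
- by case: h0 => [[_ ?]|?|?]; lra.
- by case: hN1 => [[_ ?]|?|?]; lra.
Qed.

Lemma abelian_period_reduction (alpha rho : R) conv i0 L m theta q q' K p p' (a b : R) :
  0 < alpha < 1 -> theta = alpha \/ theta = - alpha ->
  convergents theta q q' K p p' a b ->
  (q < m < K * q + q')%N -> (forall t, m <> t * q)%N -> (forall l, m <> l * q + q')%N ->
  let w := mkseq (fun j => sturmian conv alpha rho (i0 + j)) L in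
  abelian_period w m -> abelian_period w (m %/ q * q).
Proof.
move=> ha ht cv mb mmul msemi; set x := fun j => _.
have x01 j : (x j <= 1)%N by exact: sturmian_le1.
have bal : balanced alpha (fun i => (ones x i)%:Z) := sturmian_balanced _ _ _ ha.
move=> w /(tiling_of_abelian_period x01) [c tl].
have /andP[a_lo a_hi] := convergents_alpha_itv ha ht cv.
have [em r0 /andP[t0 tK] q2] := quotient_facts cv mb mmul msemi.
set t := (m %/ q)%N in em t0 tK *.
have [q'_gt0 q'_lt _ _ bE _ b_gt0 Kb_lt_a _] := cv.
have tb0 : 0 <= t%:R * b by rewrite mulr_ge0 // ltW.
have tb : t%:R * b < a by apply: le_lt_trans Kb_lt_a; rewrite ler_pM2r // ler_nat.
have [C tlC dC] : exists2 C, tiling (fun i => (ones x i)%:Z) L (t * q) C &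
    - (1 - alpha) <= (t * q)%:R * alpha - C%:~R <= alpha.
  (* For [theta = - alpha] the reduction is applied to [- F], and the count of ones per block
     changes sign. *)
  case: ht => ht; rewrite ht in cv bE.
  - exists (t%:Z * p); first exact: (tiling_reduction cv bal mb mmul msemi tl).
    rewrite natrM intrM -pmulrn; have -> : t%:R * q%:R * alpha - t%:R * p%:~R = t%:R * b.
      by rewrite bE; ring.
    by apply/andP; split; lra.
  - exists (- (t%:Z * p)).
      have := tilingN (tiling_reduction cv (balancedN bal) mb mmul msemi (tilingN tl)).
      by case=> s [E [h1 h2 h3 h4 run]]; exists s, E; split => // j /run; rewrite !opprK.
    rewrite natrM intrN intrM -pmulrn.
    have -> : t%:R * q%:R * alpha - - (t%:R * p%:~R) = - (t%:R * b) by rewrite bE; ring.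
    by apply/andP; split; lra.
apply: (abelian_period_of_tiling x01 tlC).
exact: (short_block ha bal dC).
Qed.

End Sturmian.

Theorem theorem1p4 (R : realType) (alpha : R) (w : seq nat) (m : nat) :
  0 < alpha < 2^-1 -> irrational alpha ->
  w != [::] -> sturmian_factor alpha w -> min_abelian_period w m ->
  (exists k t : nat,
      [/\ (1 <= t)%N, (t <= cf_a alpha k.+1)%N & m = (t * cf_q alpha k)%N])
  \/
  (exists k l : nat,
      [/\ (1 <= k)%N, (1 <= l)%N, (l < cf_a alpha k.+1)%N
        & m = (l * cf_q alpha k + cf_q alpha k.-1)%N]).
Proof.
move=> ha irr _ [conv [rho [i0 [_ wE]]]].
have ha1 : 0 < alpha < 1 by case/andP: ha => a0 a2; apply/andP; split; lra.
have {}wE : w = mkseq (fun j => sturmian conv alpha rho (i0 + j)) (size w) by [].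
move: (size w) wE => L -> [per minp].
have [c [s [e [sm _ _ _ _]]]] :=
  tiling_of_abelian_period (fun j => sturmian_le1 conv alpha rho (i0 + j)) per.
have m0 : (0 < m)%N := leq_ltn_trans (leq0n s) sm.
have exk : exists k, (m < cf_q alpha k)%N by exists m; apply: cf_q_gt.
(* The least such index locates [m] between two consecutive denominators; below [q_1], [m] is a
   multiple of [q_0 = 1]. *)
case: (ex_minnP exk) => -[|k] mk kmin; first by rewrite /= in mk; lia.
have {}kmin : (cf_q alpha k <= m)%N by rewrite leqNgt; apply/negP => /kmin; rewrite ltnn.
case: k kmin mk => [|k] kmin mk.
  by left; exists 0%N, m; rewrite muln1; split => //; exact: ltnW.
have [theta [p [p' [a [b [ht cv _]]]]]] := cf_convergents ha irr k.
have q'_gt0 := cv_q'_gt0 cv; have q'_lt := cv_q'_lt cv.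
rewrite [cf_q alpha k.+2]/(cf_a alpha k.+2 * cf_q alpha k.+1 + cf_q alpha k)%N in mk.
set K := cf_a alpha k.+2 in cv mk; set q := cf_q alpha k.+1 in cv kmin mk q'_lt.
set q' := cf_q alpha k in cv mk q'_gt0 q'_lt.
have q0 : (0 < q)%N := leq_ltn_trans (leq0n _) q'_lt.
have [/dvdnP[t mE]|ndiv] := boolP (q %| m)%N.
  left; exists k.+1, t; split => //; first by case: t mE m0 => // ->; rewrite mul0n.
  by rewrite -/K -ltnS -(ltn_pmul2r q0) -mE mulSn (leq_trans mk) //; move: q'_lt; rewrite -/q -/q'; lia.
have [/dvdnP[l mE]|nsemi] := boolP (q %| m - q')%N.
  have {}mE : m = (l * q + q')%N by rewrite -mE subnK // (leq_trans (ltnW q'_lt)).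
  right; exists k.+1, l; split => //.
    by case: l mE kmin => // ->; rewrite mul0n leqNgt q'_lt.
  by move: mk; rewrite mE ltn_add2r ltn_pmul2r.
have mmul t : m <> (t * q)%N by move=> mE; rewrite mE dvdn_mull in ndiv.
have msemi l : m <> (l * q + q')%N by move=> mE; rewrite mE addnK dvdn_mull in nsemi.
have mb : (q < m < K * q + q')%N.
  by rewrite mk andbT ltn_neqAle kmin andbT; apply/eqP => mE; apply: (mmul 1%N); rewrite mul1n.
(* In the remaining case [(m %/ q) q] is an abelian period, smaller than [m] because [q] does not
   divide [m]. *)
have /minp := abelian_period_reduction ha1 ht cv mb mmul msemi per.
by rewrite leqNgt ltn_neqAle leq_trunc_div andbT; case: eqP => // /esym /mmul.
Qed.
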